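(* Let $a=1+a_2\mathbf j+a_3\mathbf k$ with $a_2,a_3\in\mathbb R$, $a_2^2+a_3^2=1$, and let $c=c_0+c_1\mathbf i+c_2\mathbf j+c_3\mathbf k\in\mathbb H_s$. The equation $ax^2+c=0$ is solvable in $\mathbb H_s$ if and only if $ac=2c$. When it is solvable: (1) If $c_1=0$, then $ax^2+c=0$ has the solutions $x=x_1\mathbf i+x_2\mathbf j+x_3\mathbf k$, where $x_1,x_2,x_3\in\mathbb R$ and $-x_1^2+x_2^2+x_3^2+c_0=0$. Moreover, if $c_0\le0$, then $ax^2+c=0$ also has the solutions $$x=\pm\sqrt{-c_0}-a_2x_2-a_3x_3+(a_2x_3-a_3x_2)\mathbf i+x_2\mathbf j+x_3\mathbf k,\quad\forall x_2,x_3\in\mathbb R.$$ (2) If $c_1\ne0$, then $ax^2+c=0$ has the solutions $x=T+x_1\mathbf i+x_2\mathbf j+x_3\mathbf k$, $\forall x_2,x_3\in\mathbb R$, where $T\in\mathbb R$ is a solution of the quartic equation $$z^4+2(a_2x_2+a_3x_3)z^3+[(a_2x_2+a_3x_3)^2+c_0]z^2+(a_2x_3-a_3x_2)c_1z-\frac{c_1^2}{4}=0$$ and $x_1=\frac{-c_1}{2T}+a_2x_3-a_3x_2$.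
   Context: $\mathbb H_s$ is the split quaternion algebra: the 4-dimensional associative real algebra with basis $1,\mathbf i,\mathbf j,\mathbf k$ and $\mathbf i^2=-1$, $\mathbf j^2=\mathbf k^2=1$, $\mathbf i\mathbf j=\mathbf k=-\mathbf j\mathbf i$, $\mathbf j\mathbf k=-\mathbf i=-\mathbf k\mathbf j$, $\mathbf k\mathbf i=\mathbf j=-\mathbf i\mathbf k$. The condition $a_2^2+a_3^2=1$ says that $a$ is a zero divisor ($I_a=0$, where $I_x=x_0^2+x_1^2-x_2^2-x_3^2$). *)

(* Defs.v *)
From HB Require Import structures.
From mathcomp Require Import all_boot all_order all_algebra.
From mathcomp Require Import ring reals.

Set Implicit Arguments.
Unset Strict Implicit.
Unset Printing Implicit Defensive.

Import Order.TTheory GRing.Theory Num.Theory.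
Local Open Scope ring_scope.

(* [SQ x0 x1 x2 x3] is x0 + x1 i + x2 j + x3 k (see [splitquatE]). *)
Record splitquat (R : Type) := SQ { sq0 : R; sq1 : R; sq2 : R; sq3 : R }.

Section Carrier.
Variable R : Type.

Definition sq_to_prod (x : splitquat R) : R * R * R * R :=
  (sq0 x, sq1 x, sq2 x, sq3 x).

Definition prod_to_sq (p : R * R * R * R) : splitquat R :=
  let: (x0, x1, x2, x3) := p in SQ x0 x1 x2 x3.

Lemma sq_to_prodK : cancel sq_to_prod prod_to_sq.
Proof. by case. Qed.
End Carrier.

HB.instance Definition _ (R : eqType) :=
  Equality.copy (splitquat R) (can_type (@sq_to_prodK R)).
HB.instance Definition _ (R : choiceType) :=
  Choice.copy (splitquat R) (can_type (@sq_to_prodK R)).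

Section Algebra.
Variable R : realType.
Local Notation H := (splitquat R).
Implicit Types x y : H.

Definition sqzero : H := SQ 0 0 0 0.

Definition sqadd x y : H :=
  SQ (sq0 x + sq0 y) (sq1 x + sq1 y) (sq2 x + sq2 y) (sq3 x + sq3 y).

Definition sqopp x : H := SQ (- sq0 x) (- sq1 x) (- sq2 x) (- sq3 x).

Definition sqone : H := SQ 1 0 0 0.

(* The bilinear extension of the multiplication table proved below. *)
Definition sqmul x y : H :=
  let: SQ x0 x1 x2 x3 := x in let: SQ y0 y1 y2 y3 := y in
  SQ (x0 * y0 - x1 * y1 + x2 * y2 + x3 * y3)
     (x0 * y1 + x1 * y0 - x2 * y3 + x3 * y2)
     (x0 * y2 + x2 * y0 - x1 * y3 + x3 * y1)
     (x0 * y3 + x3 * y0 + x1 * y2 - x2 * y1).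

Definition sqscale (r : R) x : H :=
  SQ (r * sq0 x) (r * sq1 x) (r * sq2 x) (r * sq3 x).

Fact sqaddA : associative sqadd.
Proof. by move=> [????] [????] [????]; rewrite /sqadd /=; congr SQ; ring. Qed.
Fact sqaddC : commutative sqadd.
Proof. by move=> [????] [????]; rewrite /sqadd /=; congr SQ; ring. Qed.
Fact sqadd0 : left_id sqzero sqadd.
Proof. by move=> [????]; rewrite /sqadd /=; congr SQ; ring. Qed.
Fact sqaddN : left_inverse sqzero sqopp sqadd.
Proof. by move=> [????]; rewrite /sqadd /sqzero /=; congr SQ; ring. Qed.

HB.instance Definition _ :=
  GRing.isZmodule.Build H sqaddA sqaddC sqadd0 sqaddN.

Fact sqmulA : associative sqmul.
Proof. by move=> [????] [????] [????]; rewrite /sqmul /=; congr SQ; ring. Qed.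
Fact sqmul1l : left_id sqone sqmul.
Proof. by move=> [????]; rewrite /sqmul /=; congr SQ; ring. Qed.
Fact sqmul1r : right_id sqone sqmul.
Proof. by move=> [????]; rewrite /sqmul /=; congr SQ; ring. Qed.
Fact sqmulDl : left_distributive sqmul sqadd.
Proof.
by move=> [????] [????] [????]; rewrite /sqmul /sqadd /=; congr SQ; ring.
Qed.
Fact sqmulDr : right_distributive sqmul sqadd.
Proof.
by move=> [????] [????] [????]; rewrite /sqmul /sqadd /=; congr SQ; ring.
Qed.
Fact sqone_neq0 : sqone != 0.
Proof. by apply/eqP => -[] /eqP; rewrite oner_eq0. Qed.

HB.instance Definition _ := GRing.Zmodule_isNzRing.Build H
  sqmulA sqmul1l sqmul1r sqmulDl sqmulDr sqone_neq0.

Fact sqscaleA (r s : R) x : sqscale r (sqscale s x) = sqscale (r * s) x.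
Proof. by rewrite /sqscale /=; congr SQ; ring. Qed.
Fact sqscale1 : left_id 1 sqscale.
Proof. by move=> [????]; rewrite /sqscale /=; congr SQ; ring. Qed.
Fact sqscaleDr : right_distributive sqscale +%R.
Proof. by move=> ? [????] [????]; congr SQ; rewrite /=; ring. Qed.
Fact sqscaleDl x : {morph sqscale^~ x : r s / r + s}.
Proof.
by move=> r s; rewrite /sqscale; case: x => ????; congr SQ; rewrite /=; ring.
Qed.

HB.instance Definition _ := GRing.Zmodule_isLmodule.Build R H
  sqscaleA sqscale1 sqscaleDr sqscaleDl.

Fact sqscaleAl (r : R) x y : r *: (x * y) = r *: x * y.
Proof. by case: x y => [????] [????]; congr SQ; rewrite /=; ring. Qed.
Fact sqscaleAr (r : R) x y : r *: (x * y) = x * (r *: y).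
Proof. by case: x y => [????] [????]; congr SQ; rewrite /=; ring. Qed.

HB.instance Definition _ := GRing.Lmodule_isLalgebra.Build R H sqscaleAl.
HB.instance Definition _ := GRing.Lalgebra_isAlgebra.Build R H sqscaleAr.

Definition qi : H := SQ 0 1 0 0.
Definition qj : H := SQ 0 0 1 0.
Definition qk : H := SQ 0 0 0 1.

Lemma splitquatE (x0 x1 x2 x3 : R) :
  SQ x0 x1 x2 x3 = x0%:A + x1 *: qi + x2 *: qj + x3 *: qk.
Proof. by congr SQ; rewrite /=; ring. Qed.

Lemma splitquat_table :
  [/\ qi * qi = -1, qj * qj = 1 & qk * qk = 1] /\
  [/\ qi * qj = qk, qj * qi = - qk, qj * qk = - qi & qk * qj = qi] /\
  (qk * qi = qj /\ qi * qk = - qj).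
Proof. by do ?split; congr SQ; rewrite /=; ring. Qed.

End Algebra.

Arguments qi {R}.
Arguments qj {R}.
Arguments qk {R}.

Definition quartic (R : realType) (a2 a3 c0 c1 x2 x3 z : R) : R :=
  z ^+ 4 + 2 * (a2 * x2 + a3 * x3) * z ^+ 3
  + ((a2 * x2 + a3 * x3) ^+ 2 + c0) * z ^+ 2
  + (a2 * x3 - a3 * x2) * c1 * z - c1 ^+ 2 / 4.

(* Main.v *)
Require Import Defs.
From HB Require Import structures.
From mathcomp Require Import all_boot all_order all_algebra.
From mathcomp Require Import reals.
From mathcomp Require Import ring lra.

Import Order.TTheory GRing.Theory Num.Theory.
Local Open Scope ring_scope.

(** Since a2^2 + a3^2 = 1, the zero divisor a satisfies a^2 = 2a. Hence the
    values of left multiplication by a are exactly the c with a c = 2 c; they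
    form a real plane, on which the coordinates along 1 and i are free and
    determine the other two ([zdiv_mulE], [zdiv_eigenP]). This
    gives the necessity of a c = 2 c, and when that holds it leaves of the four
    real equations in a x^2 + c = 0 only those along 1 and i. With
    p = a2 x2 + a3 x3 and q = a2 x3 - a3 x2, so that
    p^2 + q^2 = x2^2 + x3^2 ([rotation_sqrD]), they read ([zdiv_equationP])
      (x0 + p)^2 - x1^2 + q^2 + c0 = 0   and   2 x0 (x1 - q) + c1 = 0.

    If c1 = 0, the second one says that x0 = 0 or x1 = q, and the first one
    becomes the equation of a quadric, respectively (x0 + p)^2 = - c0. The
    quadric has real points whatever c0 is, so the equation is solvable.

    If c1 <> 0, then x0 <> 0, the second one gives x1 = q - c1 / (2 x0), and the
    first one multiplied by x0^2 is the quartic at x0. The quartic is monic with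
    negative value - c1^2 / 4 at 0, so it has a real root by the intermediate
    value theorem, whatever x2 and x3 are ([monic_quartic_root]); this gives
    solvability here as well. *)

(** Beyond 1 + |b| + |c| + |d| + |e| the leading term dominates, so the
    intermediate value theorem applies between 0 and that bound. *)
Lemma monic_quartic_root (R : rcfType) (b c d e : R) : e <= 0 ->
  exists z : R, z ^+ 4 + b * z ^+ 3 + c * z ^+ 2 + d * z + e = 0.
Proof.
move=> e_le0.
pose P : {poly R} := 'X^4 + b *: 'X^3 + c *: 'X^2 + d *: 'X + e%:P.
have PE z : P.[z] = z ^+ 4 + b * z ^+ 3 + c * z ^+ 2 + d * z + e.
  by rewrite /P !hornerE.
pose M := 1 + `|b| + `|c| + `|d| + `|e|.
have [b0 c0 d0 e0] : [/\ 0 <= `|b|, 0 <= `|c|, 0 <= `|d| & 0 <= `|e|].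
  by split; apply: normr_ge0.
have M1 : 1 <= M by rewrite /M; lra.
have M0 : 0 <= M by lra.
have M2 : M <= M ^+ 2 by rewrite -[leLHS]expr1 ler_weXn2l.
have M3 : M ^+ 2 <= M ^+ 3 by rewrite ler_weXn2l.
have lower (t m : R) : 0 <= m -> m <= M ^+ 3 -> - (`|t| * M ^+ 3) <= t * m.
  move=> m0 mM; apply: (@le_trans _ _ (- (`|t| * m))).
    by rewrite lerN2 ler_wpM2l.
  by rewrite -mulNr ler_wpM2r // lerNl ler_normr lexx orbT.
have PM : 0 <= P.[M].
  have hb := lower b (M ^+ 3) (exprn_ge0 _ M0) (lexx _).
  have hc := lower c (M ^+ 2) (exprn_ge0 _ M0) M3.
  have hd := lower d M M0 (le_trans M2 M3).
  have he := lower e 1 ler01 (le_trans M1 (le_trans M2 M3)).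
  have h3 : 0 <= M ^+ 3 by apply: exprn_ge0.
  have h4 : M ^+ 4 = M ^+ 3 + `|b| * M ^+ 3 + `|c| * M ^+ 3 + `|d| * M ^+ 3
                     + `|e| * M ^+ 3.
    by rewrite exprS {1}/M; ring.
  by rewrite PE h4; lra.
have P0 : P.[0] <= 0 by rewrite PE !expr0n !mulr0 !add0r.
have [z _ Pz] : exists2 z, 0 <= z <= M & root P z.
  by apply: poly_ivt => //; rewrite P0 PM.
by exists z; rewrite -PE; apply/eqP.
Qed.

Section ZeroDivisor.
Variables (R : realType) (a2 a3 : R).
Hypothesis unit_circle : a2 ^+ 2 + a3 ^+ 2 = 1.

Local Notation a := (SQ 1 0 a2 a3).

Let a2_sqr : a2 ^+ 2 = 1 - a3 ^+ 2.
Proof. by rewrite -unit_circle addrK. Qed.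

(** The left-hand side is the squared norm of the image of (x2, x3) under a
    rotation, the one that takes (a2, a3) to (1, 0). *)
Lemma rotation_sqrD (x2 x3 : R) :
  (a2 * x2 + a3 * x3) ^+ 2 + (a2 * x3 - a3 * x2) ^+ 2 = x2 ^+ 2 + x3 ^+ 2.
Proof. by ring: a2_sqr. Qed.

(** The range of left multiplication by [a], parametrised by its coordinates
    along 1 and i. *)
Definition zdiv_plane (s t : R) : splitquat R :=
  SQ s t (a2 * s + a3 * t) (a3 * s - a2 * t).

Lemma zdiv_planeD (s t s' t' : R) :
  zdiv_plane s t + zdiv_plane s' t' = zdiv_plane (s + s') (t + t').
Proof. by congr SQ; rewrite /=; ring. Qed.

Lemma zdiv_plane_eq0 (s t : R) : zdiv_plane s t = 0 <-> s = 0 /\ t = 0.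
Proof.
split=> [[-> -> _ _] // | [-> ->]].
by congr SQ; ring.
Qed.

Lemma zdiv_mulE (y : splitquat R) :
  a * y = zdiv_plane (sq0 y + a2 * sq2 y + a3 * sq3 y)
                     (sq1 y - a2 * sq3 y + a3 * sq2 y).
Proof. by case: y => y0 y1 y2 y3; congr SQ; rewrite /=; ring: a2_sqr. Qed.

Lemma zdiv_eigen_plane (s t : R) : a * zdiv_plane s t = 2 *: zdiv_plane s t.
Proof.
rewrite zdiv_mulE /zdiv_plane /=.
by congr SQ; rewrite /=; ring: a2_sqr.
Qed.

(** The vectors that [a] doubles are those of its range: one direction because
    [a ^+ 2 = 2 *: a], the other because c is then half of [a * c]. *)
Lemma zdiv_eigenP (c : splitquat R) :
  a * c = 2 *: c <-> c = zdiv_plane (sq0 c) (sq1 c).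
Proof.
split=> [|->]; last exact: zdiv_eigen_plane.
rewrite zdiv_mulE; case: c => c0 c1 c2 c3 /=.
move=> [/= h0 h1 h2 h3]; rewrite /zdiv_plane; congr SQ; move: h2 h3.
  by rewrite h0 h1; lra.
by rewrite h0 h1; lra.
Qed.

Lemma zdiv_solvable_eigen (x c : splitquat R) :
  a * x ^+ 2 + c = 0 -> a * c = 2 *: c.
Proof.
rewrite addrC => /eqP; rewrite addr_eq0 => /eqP ->.
by rewrite mulrN scalerN zdiv_mulE zdiv_eigen_plane.
Qed.

(** The equations along 1 and i, with x2^2 + x3^2 traded for p^2 + q^2: then x1
    and q only occur through x1 - q and x1^2 - q^2, both of which vanish when
    x1 = q. *)
Lemma zdiv_equationP (x0 x1 x2 x3 s t : R) :
  a * SQ x0 x1 x2 x3 ^+ 2 + zdiv_plane s t = 0 <->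
  (x0 + (a2 * x2 + a3 * x3)) ^+ 2 - x1 ^+ 2 + (a2 * x3 - a3 * x2) ^+ 2 + s = 0
  /\ 2 * x0 * (x1 - (a2 * x3 - a3 * x2)) + t = 0.
Proof.
rewrite zdiv_mulE zdiv_planeD zdiv_plane_eq0 /=.
have norm_pq := rotation_sqrD x2 x3.
split=> -[e0 e1]; split; lra.
Qed.

(** The quadric x1^2 - x2^2 - x3^2 = s has real points whatever the sign of s,
    because s is the difference of the squares of (s + 1) / 2 and (s - 1) / 2. *)
Lemma zdiv_equation_pure_root (s : R) :
  a * SQ 0 ((s + 1) / 2) ((s - 1) / 2 * a2) ((s - 1) / 2 * a3) ^+ 2
    + zdiv_plane s 0 = 0.
Proof.
by apply/zdiv_equationP; split; field: a2_sqr.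
Qed.

Lemma quartic_has_root (c0 c1 x2 x3 : R) :
  exists T : R, quartic a2 a3 c0 c1 x2 x3 T = 0.
Proof.
have e_le0 : - c1 ^+ 2 / 4 <= 0 by have := sqr_ge0 c1; lra.
have [T rootT] := monic_quartic_root _ (2 * (a2 * x2 + a3 * x3))
  ((a2 * x2 + a3 * x3) ^+ 2 + c0) ((a2 * x3 - a3 * x2) * c1) _ e_le0.
by exists T; rewrite -[RHS]rootT /quartic mulNr.
Qed.

Lemma quartic_root_neq0 (c0 c1 x2 x3 T : R) :
  c1 != 0 -> quartic a2 a3 c0 c1 x2 x3 T = 0 -> T != 0.
Proof.
move=> c1_neq0; apply: contra_eq_neq => ->.
have c1_sqr_gt0 : 0 < c1 ^+ 2 by rewrite exprn_even_gt0 ?c1_neq0 ?orbT.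
by rewrite /quartic !expr0n /=; lra.
Qed.

(** Since x0 (x1 - q) = - c1 / 2 is nonzero, so is x0, and x1 is determined; the
    quartic is the equation along 1 with x1 eliminated, cleared of its
    denominator x0^2. *)
Lemma zdiv_equation_quarticP (x0 x1 x2 x3 c0 c1 : R) : c1 != 0 ->
  a * SQ x0 x1 x2 x3 ^+ 2 + zdiv_plane c0 c1 = 0 <->
  quartic a2 a3 c0 c1 x2 x3 x0 = 0 /\
  x1 = - c1 / (2 * x0) + a2 * x3 - a3 * x2.
Proof.
move=> c1_neq0; rewrite zdiv_equationP.
have quarticE : x0 != 0 -> x1 = - c1 / (2 * x0) + a2 * x3 - a3 * x2 ->
    quartic a2 a3 c0 c1 x2 x3 x0 =
    x0 ^+ 2 * ((x0 + (a2 * x2 + a3 * x3)) ^+ 2 - x1 ^+ 2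
               + (a2 * x3 - a3 * x2) ^+ 2 + c0).
  by move=> x0_neq0 ->; rewrite /quartic; field.
split=> [[e0 e1]|[rootx x1E]].
  have x0_neq0 : x0 != 0.
    by apply: contra_neq c1_neq0 => x0_eq0; move: e1; rewrite x0_eq0; lra.
  have x1E : x1 = - c1 / (2 * x0) + a2 * x3 - a3 * x2.
    have -> : c1 = - (2 * x0 * (x1 - (a2 * x3 - a3 * x2))) by lra.
    by field.
  by rewrite quarticE // e0 mulr0.
have x0_neq0 := quartic_root_neq0 _ _ _ _ _ c1_neq0 rootx.
split; last by rewrite x1E; field.
have /eqP := rootx; rewrite quarticE // mulf_eq0 expf_eq0 (negPf x0_neq0) /=.
by move/eqP.
Qed.

Lemma zdiv_equation_solvable (c0 c1 : R) :
  exists x : splitquat R, a * x ^+ 2 + zdiv_plane c0 c1 = 0.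
Proof.
have [->|c1_neq0] := eqVneq c1 0.
  by eexists; apply: zdiv_equation_pure_root.
have [T rootT] := quartic_has_root c0 c1 0 0.
exists (SQ T (- c1 / (2 * T) + a2 * 0 - a3 * 0) 0 0).
exact/zdiv_equation_quarticP.
Qed.

(** The two branches come from the product x0 (x1 - q) being 0. *)
Lemma zdiv_equation_c1_eq0P (x0 x1 x2 x3 c0 : R) :
  a * SQ x0 x1 x2 x3 ^+ 2 + zdiv_plane c0 0 = 0 <->
  (x0 = 0 /\ - x1 ^+ 2 + x2 ^+ 2 + x3 ^+ 2 + c0 = 0) \/
  (x1 = a2 * x3 - a3 * x2 /\ (x0 + a2 * x2 + a3 * x3) ^+ 2 = - c0).
Proof.
rewrite zdiv_equationP addr0.
have norm_pq := rotation_sqrD x2 x3.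
split=> [[e0 /eqP]|[[-> e0]|[-> e0]]].
- rewrite !mulf_eq0 pnatr_eq0 /= subr_eq0 => /orP[/eqP x0E|/eqP x1E].
    by left; move: e0; rewrite x0E add0r; split=> //; lra.
  by right; move: e0; rewrite x1E addrA; split=> //; lra.
- by rewrite add0r; split; lra.
- by rewrite subrr mulr0 addrA e0; split=> //; lra.
Qed.

End ZeroDivisor.

Lemma sqr_eqNP (R : rcfType) (y s : R) :
  y ^+ 2 = - s <-> s <= 0 /\ (y = Num.sqrt (- s) \/ y = - Num.sqrt (- s)).
Proof.
split=> [y2|[s_le0 [->|->]]]; last 2 first.
- by rewrite sqr_sqrtr // oppr_ge0.
- by rewrite sqrrN sqr_sqrtr // oppr_ge0.
rewrite -oppr_ge0 -y2 sqrtr_sqr sqr_ge0; split=> //.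
by case: (ger0P y) => _; [left | right; rewrite opprK].
Qed.

Theorem theorem4p1 (R : realType) (a2 a3 c0 c1 c2 c3 : R)
    (a c : splitquat R)
    (ha : a = 1 + a2 *: qj + a3 *: qk)
    (ha23 : a2 ^+ 2 + a3 ^+ 2 = 1)
    (hc : c = c0%:A + c1 *: qi + c2 *: qj + c3 *: qk) :
  ((exists x : splitquat R, a * x ^+ 2 + c = 0) <-> a * c = 2 *: c) /\
  ((exists x : splitquat R, a * x ^+ 2 + c = 0) ->
    (c1 = 0 ->
      forall x : splitquat R,
        a * x ^+ 2 + c = 0 <->
        (exists x1 x2 x3 : R,
            - x1 ^+ 2 + x2 ^+ 2 + x3 ^+ 2 + c0 = 0 /\
            x = x1 *: qi + x2 *: qj + x3 *: qk)
        \/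
        (c0 <= 0 /\
         exists x2 x3 : R,
            x = (Num.sqrt (- c0) - a2 * x2 - a3 * x3)%:A
                + (a2 * x3 - a3 * x2) *: qi + x2 *: qj + x3 *: qk \/
            x = (- Num.sqrt (- c0) - a2 * x2 - a3 * x3)%:A
                + (a2 * x3 - a3 * x2) *: qi + x2 *: qj + x3 *: qk)) /\
    (c1 <> 0 ->
      (forall x2 x3 : R, exists T : R, quartic a2 a3 c0 c1 x2 x3 T = 0) /\
      forall x : splitquat R,
        a * x ^+ 2 + c = 0 <->
        exists x2 x3 T x1 : R,
          quartic a2 a3 c0 c1 x2 x3 T = 0 /\
          x1 = - c1 / (2 * T) + a2 * x3 - a3 * x2 /\
          x = T%:A + x1 *: qi + x2 *: qj + x3 *: qk)).
Proof.
have aE : a = SQ 1 0 a2 a3 by rewrite ha; congr SQ; rewrite /=; ring.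
have cE : c = SQ c0 c1 c2 c3 by rewrite hc -splitquatE.
have pureE (x1 x2 x3 : R) :
    x1 *: qi + x2 *: qj + x3 *: qk = SQ 0 x1 x2 x3.
  by rewrite splitquatE scale0r add0r.
clear ha hc; subst a; split.
  split=> [[x /(zdiv_solvable_eigen _ _ _ ha23)]//|].
  by move/(zdiv_eigenP _ _ _ ha23) ->; apply: zdiv_equation_solvable.
case=> x /(zdiv_solvable_eigen _ _ _ ha23)/(zdiv_eigenP _ _ _ ha23).
rewrite cE => {c x cE} ->; split=> /= [-> | /eqP c1_neq0].
  case=> x0 x1 x2 x3; rewrite zdiv_equation_c1_eq0P // sqr_eqNP; split.
  - case=> [[-> e]|[-> [c0_le0 xE]]].
      by left; exists x1, x2, x3; rewrite pureE.
    right; split=> //; exists x2, x3; rewrite -!splitquatE.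
    by case: xE => <-; [left | right]; congr SQ; ring.
  - case=> [[y1 [y2 [y3 [e]]]]|[c0_le0 [y2 [y3]]]].
      by rewrite pureE => -[-> -> -> ->]; left.
    rewrite -!splitquatE => -[[-> -> -> ->]|[-> -> -> ->]]; right.
      by do 2![split=> //]; left; ring.
    by do 2![split=> //]; right; ring.
split=> [x2 x3|]; first exact: quartic_has_root.
case=> x0 x1 x2 x3; rewrite zdiv_equation_quarticP //; split.
  by case=> rootx x1E; exists x2, x3, x0, x1; rewrite -splitquatE.
case=> y2 [y3 [T [y1 [rootT [y1E]]]]].
by rewrite -splitquatE => -[-> -> -> ->].
Qed.
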